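(* Let $c,m,n$ be positive integers such that $n-\frac12 n^{2/3}\le m\le n$. Then \[L_{c,m,n}\ge \lambda_2(c)\cdot n\,e^{3(n-m)},\] where $\lambda_2(c):=\dfrac{e^{-\frac{2\pi^2}{3}c-\frac{5}{12}}}{(2\pi)^{3/2}c}$.
   Context: $L_{c,m,n}:=\mathrm{lcm}\{m^2+c,(m+1)^2+c,\dots,n^2+c\}$. *)

(* Defs.v *)
From mathcomp Require Import all_boot all_order all_algebra.
From mathcomp Require Import reals sequences exp trigo.

Set Implicit Arguments.
Unset Strict Implicit.
Unset Printing Implicit Defensive.

Import Order.TTheory GRing.Theory Num.Theory.
Local Open Scope ring_scope.

Definition lcm_quad (c m n : nat) : nat :=
  \big[lcmn/1%N]_(m <= k < n.+1) (k ^ 2 + c)%N.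

Definition lambda2 (R : realType) (c : nat) : R :=
  expR (- (2 * pi ^+ 2 / 3) * c%:R - 5 / 12) / ((2 * pi) `^ (3 / 2) * c%:R).

(* Main.v *)
Require Import Defs.
From mathcomp Require Import all_boot all_order all_algebra.
From mathcomp Require Import algC algnum.
From mathcomp Require Import reals sequences exp trigo.
From mathcomp Require Import ring lra zify.

Import Order.TTheory GRing.Theory Num.Theory.
Local Open Scope ring_scope.

(**
Put N = n - m and L = lcm_quad c m n. For w a square root of -c, the partial
fraction expansion of N! / ((m + w) ... (n + w)) has integer coefficients over
the poles k + w, each of which divides k^2 + c, hence L, in Z[w]. So
L N! / ((m + w) ... (n + w)) is an algebraic integer; multiplying by the same
number for -w shows that the product of the k^2 + c divides (L N!)^2, and
therefore L >= m (m + 1) ... n / N! = n C(n-1, N).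

The hypothesis on m says (2N)^3 <= n^2. Since pi >= 2 and c >= 1, lambda2 c is at
most e^-3 / 8, so it remains to see e^(3N) <= 8 e^3 C(n-1, N). With y = 2N, the
tangent to y^(3/2) at y = 9 gives n >= 9 N - 27/2, and C(9N-14, N) grows at rate
9^9 / 8^8 > 23 > e^3.
*)

(** Induction on [N] replaces explicit partial fractions: the two end factors differ by [N + 1], so
    the quotient for [N + 1] is the difference of the quotients for [N] starting at [m] and at
    [m + 1]. *)
Lemma fact_mul_div_prod_Aint (L : algC) (N m : nat) (w : algC)
    (w0 : forall k, (m <= k <= m + N)%N -> k%:R + w != 0)
    (Lw : forall k, (m <= k <= m + N)%N -> L / (k%:R + w) \in Aint) :
  L * N`!%:R / (\prod_(m <= k < (m + N).+1) (k%:R + w)) \in Aint.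
Proof.
elim: N m w0 Lw => [|N IHN] m w0 Lw.
  by rewrite addn0 big_nat1 mulr1 Lw // addn0 leqnn.
have IH1 := IHN m (fun k hk => w0 k ltac:(lia)) (fun k hk => Lw k ltac:(lia)).
have IH2 := IHN m.+1 (fun k hk => w0 k ltac:(lia)) (fun k hk => Lw k ltac:(lia)).
suff -> : L * N.+1`!%:R / \prod_(m <= k < (m + N.+1).+1) (k%:R + w) =
   L * N`!%:R / \prod_(m <= k < (m + N).+1) (k%:R + w) -
   L * N`!%:R / \prod_(m.+1 <= k < (m.+1 + N).+1) (k%:R + w) by apply: rpredB.
have le1 : (m.+1 <= (m + N).+1)%N by lia.
have -> : (m + N.+1 = (m + N).+1)%N by lia.
have -> : (m.+1 + N = (m + N).+1)%N by lia.
rewrite (@big_ltn _ _ _ m (m + N).+2) ?(@big_ltn _ _ _ m (m + N).+1); try lia.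
rewrite !(big_nat_recr (m + N).+1 m.+1) //=.
have := w0 m ltac:(lia); have := w0 (m + N).+1 ltac:(lia).
rewrite (_ : (m + N).+1%:R = m%:R + N.+1%:R); last by rewrite -natrD addnS.
set P := \prod_(_ <= _ < _) _.
have : P != 0.
  rewrite /P prodf_seq_neq0; apply/allP => k; rewrite mem_index_iota => hk.
  by apply/implyP => _; apply: w0; lia.
rewrite factS natrM.
move: P (m%:R : algC) (N.+1%:R : algC) (N`!%:R : algC) => P x y z P0 xy0 x0.
by field; rewrite xy0 P0.
Qed.

Lemma prod_quad_dvd_sqr_lcm (c m n : nat) (c_gt0 : (0 < c)%N) (le_mn : (m <= n)%N) :
  (\prod_(m <= k < n.+1) (k ^ 2 + c) %| (lcm_quad c m n * (n - m)`!) ^ 2)%N.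
Proof.
set L := lcm_quad c m n.
pose w : algC := 'i * sqrtC c%:R.
have w2 : w ^+ 2 = - c%:R by rewrite exprMn sqrCi sqrtCK mulN1r.
have w_Aint : w \in Aint.
  apply: (@root_monic_Aint ('X^2 + c%:R%:P)); first by rewrite rootE !hornerE w2 addNr.
    exact: monicXnaddC.
  apply/polyOverP => i; rewrite coefD coefXn coefC.
  by case: (i == 0)%N; rewrite ?addr0 -?natrD rpred_nat.
have quadE k : (k ^ 2 + c)%:R = (k%:R + w) * (k%:R - w) :> algC.
  by rewrite mulrC -subr_sqr w2 opprK natrD natrX.
have quad0 k : (k ^ 2 + c)%:R != 0 :> algC by rewrite pnatr_eq0 -lt0n addn_gt0 c_gt0 orbT.
have dvdL k : (m <= k <= n)%N -> (k ^ 2 + c %| L)%N.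
  by move=> hk; rewrite /L /lcm_quad (bigD1_seq k) ?mem_index_iota ?iota_uniq ?dvdn_lcml.
have key v : (v == w) || (v == - w) ->
    L%:R * (n - m)`!%:R / (\prod_(m <= k < n.+1) (k%:R + v)) \in Aint.
  move=> hv.
  have vE k : (k ^ 2 + c)%:R = (k%:R + v) * (k%:R - v) :> algC.
    by rewrite quadE; case/orP: hv => /eqP -> //; rewrite opprK mulrC.
  have v0 k : k%:R + v != 0 by apply: contra_neq (quad0 k) => e; rewrite vE e mul0r.
  have := @fact_mul_div_prod_Aint L%:R (n - m) m v; rewrite subnKC //; apply=> // k hk.
  have /dvdnP[q ->] := dvdL k hk.
  rewrite natrM vE mulrA mulrAC mulfK //.
  rewrite rpredM ?rpredB ?rpred_nat //.
  by case/orP: hv => /eqP ->; rewrite ?rpredN.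
have := rpredM (key w ltac:(by rewrite eqxx)) (key (- w) ltac:(by rewrite eqxx orbT)).
rewrite mulrACA -invfM -big_split /=.
under eq_bigr => k _ do rewrite -quadE.
rewrite -natr_prod -expr2 -natrM -natrX => int_ratio; rewrite -dvdC_nat unfold_in.
have -> : (\prod_(m <= k < n.+1) (k ^ 2 + c))%:R == 0 :> algC = false.
  by rewrite natr_prod prodf_seq_eq0; apply/hasPn => k _; rewrite quad0.
(* A rational algebraic integer is an integer. *)
by rewrite Cint_rat_Aint // rpred_div ?rpred_nat.
Qed.

Lemma prod_nat_bin (m n : nat) : (0 < m)%N -> (m <= n)%N ->
  (\prod_(m <= k < n.+1) k = n * 'C(n.-1, n - m) * (n - m)`!)%N.
Proof.
move=> m_gt0 le_mn; apply/eqP; rewrite -(eqn_pmul2l (fact_gt0 m.-1)); apply/eqP.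
rewrite -(mulnA n) bin_ffact -ffactnS [RHS]mulnC.
have -> : m.-1 = (n - (n - m).+1)%N by lia.
rewrite ffact_fact; last by lia.
have -> : (n - (n - m).+1 = m.-1)%N by lia.
by rewrite !fact_prod prednK // -big_cat_nat //; lia.
Qed.

Lemma bin_le_lcm_quad (c m n : nat) : (0 < c)%N -> (0 < m)%N -> (m <= n)%N ->
  (n * 'C(n.-1, n - m) <= lcm_quad c m n)%N.
Proof.
move=> c_gt0 m_gt0 le_mn.
have L_gt0 : (0 < lcm_quad c m n)%N.
  rewrite /lcm_quad; elim/big_ind: _ => // [x y x0 y0|i _]; first by rewrite lcmn_gt0 x0.
  by rewrite addn_gt0 c_gt0 orbT.
have := dvdn_leq _ (prod_quad_dvd_sqr_lcm _ _ _ c_gt0 le_mn).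
rewrite expn_gt0 muln_gt0 L_gt0 fact_gt0 => /(_ isT) le_prod.
rewrite -(leq_pmul2r (fact_gt0 (n - m))) -prod_nat_bin // -leq_sqr.
(* Dropping [c] from each factor [k ^ 2 + c] leaves the square of the product of the [k]. *)
apply: leq_trans le_prod; rewrite -mulnn -big_split /=.
by apply: leq_prod => k _; rewrite -mulnn leq_addr.
Qed.

(** The ratio of the two binomials is [(p + 1) / (p + 1 - k)], which is at least 9/8 as long as
    [p + 1 <= 9 * k]. *)
Lemma bin_ratio_ge (p k : nat) : (p < 9 * k)%N -> (9 * 'C(p, k) <= 8 * 'C(p.+1, k))%N.
Proof.
move=> hp; have := mul_bin_down p.+1 k; rewrite /= => e.
have : (k <= p \/ p < k)%N by lia.
case=> hk; last by rewrite bin_small.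
nia.
Qed.

(** Raise the upper index eight times, gaining 9/8 each time, then raise both indices once, gaining
    exactly [(9 * M + 22) / (M + 4)]. *)
Lemma bin_slope9_step (R : realFieldType) (M : nat) :
  9 ^+ 8 * ((9 * M%:R + 22) * 'C(9 * M + 13, M + 3)%:R) <=
  8 ^+ 8 * ((M%:R + 4) * 'C(9 * M + 22, M + 4)%:R) :> R.
Proof.
have H i : (i <= 8)%N -> 9 ^+ i * 'C(9 * M + 13, M + 3)%:R <=
    8 ^+ i * 'C(9 * M + 13 + i, M + 3)%:R :> R.
  elim: i => [|i IHi] hi; first by rewrite addn0.
  have := @bin_ratio_ge (9 * M + 13 + i) (M + 3) ltac:(lia).
  rewrite -(ler_nat R) !natrM (addnS _ i) (exprS 9) (exprS 8) => h.
  have := IHi ltac:(lia); have : 0 <= 8 ^+ i :> R by rewrite exprn_ge0.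
  move: (8 ^+ i) (9 ^+ i) h => a b; nra.
have := mul_bin_diag (9 * M + 22) (M + 3).
have -> : (9 * M + 22).-1 = (9 * M + 13 + 8)%N by lia.
rewrite -[(M + 3).+1]addnS => /(congr1 (fun k => k%:R : R)).
rewrite (natrM _ (9 * M + 22)) (natrM _ (M + 4)) (natrD _ _ 4) (natrD _ _ 22) (natrM _ 9) => <-.
by rewrite mulrCA [leRHS]mulrCA ler_wpM2l ?H // addr_ge0 ?mulr_ge0.
Qed.

(* The factor (M + 6) / (M + 1) absorbs the first steps, whose growth ratio is
   still below 41 / 2, the upper bound used for e^3. *)
Lemma bin_slope9_ge (R : realFieldType) (M : nat) :
  (41 / 2) ^+ (M + 3) * (M%:R + 6) <= 8 * (M%:R + 1) * 'C(9 * M + 22, M + 4)%:R :> R.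
Proof.
elim: M => [|M IHM].
  by have -> : 'C(9 * 0 + 22, 0 + 4) = 7315%N by []; rewrite !add0n; lra.
have -> : (41 / 2) ^+ (M.+1 + 3) = 41 / 2 * (41 / 2) ^+ (M + 3) :> R by rewrite -exprS addSn.
have := bin_slope9_step R M.+1.
have -> : (9 * M.+1 + 13 = 9 * M + 22)%N by lia.
have -> : (M.+1 + 3 = M + 4)%N by lia.
move: IHM; rewrite -(natr1 M).
set C := 'C(9 * M + 22, _)%:R; set C' := 'C(_ , M.+1 + 4)%:R.
have hM : 0 <= M%:R :> R by [].
have hC : 0 <= C by [].
move: (M%:R) hM ((41 / 2) ^+ (M + 3) : R) C C' hC => x hx y C C' hC h1 h2.
(* With the binomials cancelled, the induction step is this cubic inequality; on [x >= 0] its margin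
   is smallest near [x = 3], whence the squares of [x - 3]. *)
have cubic : 41 / 2 * 8 ^+ 8 * ((x + 7) * (x + 1) * (x + 5)) <=
    9 ^+ 8 * ((x + 2) * (9 * x + 31) * (x + 6)) :> R.
  by have := mulr_ge0 hx (sqr_ge0 (x - 3)); have := sqr_ge0 (x - 3); nra.
have K1 : 0 <= 41 / 2 * 8 ^+ 8 * ((x + 7) * (x + 5)).
  by rewrite !mulr_ge0 ?addr_ge0 ?exprn_ge0 //; lra.
have K2 : 0 <= 8 * ((x + 2) * (x + 6)) by rewrite !mulr_ge0 ?addr_ge0.
have K3 : 0 <= 8 * C by rewrite mulr_ge0.
have e1 := ler_wpM2l K1 h1; have e2 := ler_wpM2l K2 h2; have e3 := ler_wpM2l K3 cubic.
have K : 0 < 8 ^+ 8 * ((x + 5) * (x + 6)) by rewrite !mulr_gt0 ?exprn_gt0 ?ltr_wpDl.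
rewrite -(ler_pM2l K).
lra.
Qed.

Lemma expR3_le (R : realType) : expR 3 <= 41 / 2 :> R.
Proof.
(* The bound [e^x <= 1 / (1 - x)] at [x = 3 / 256], raised to the power 256, gives about 20.44. *)
have -> : 3 = (3 / 256) * 256%:R :> R by field.
rewrite expRM_natr.
have h : expR (3 / 256) <= 256 / 253 :> R.
  have := expR_ge1Dx (- (3 / 256) : R); rewrite expRN => h.
  rewrite -[leLHS]invrK -[leRHS]invrK lef_pV2 ?posrE ?invr_gt0 ?expR_gt0 //; lra.
apply: le_trans (_ : (256 / 253) ^+ 256 <= _).
  by rewrite ler_pXn2r ?nnegrE ?expR_ge0 //; lra.
lra.
Qed.

Lemma lambda2_le (R : realType) (c : nat) : (0 < c)%N ->
  8 * lambda2 R c <= expR (- 3).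
Proof.
move=> c0; have c1 : 1 <= c%:R :> R by rewrite ler1n.
have pi2 := @pi_ge2 R.
have h8 : 8 <= (2 * pi) `^ (3 / 2) :> R.
  have -> : 8 = (2 * 2) `^ (3 / 2) :> R.
    have -> : 2 * 2 = 2 `^ 2%:R :> R by rewrite powR_mulrn //.
    rewrite -powRrM (_ : 2%:R * (3 / 2) = 3%:R); last by field.
    by rewrite powR_mulrn //; ring.
  by rewrite ge0_ler_powR ?nnegrE; nra.
have hD : 8 <= (2 * pi) `^ (3 / 2) * c%:R :> R by nra.
rewrite /lambda2 mulrA ler_pdivrMr; last by lra.
(* The exponent is at most [-(8/3 + 5/12) = -37/12]. *)
have : expR (- (2 * pi ^+ 2 / 3) * c%:R - 5 / 12) <= expR (- 3) :> R by rewrite ler_expR; nra.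
have := ler_wpM2l (expR_ge0 (- 3 : R)) hD; lra.
Qed.

Lemma cube_le_sqr_of_range (R : realType) (N n m : nat) : (m + N = n)%N ->
  n%:R - 2^-1 * n%:R `^ (2 / 3) <= m%:R :> R -> (8 * N ^ 3 <= n ^ 2)%N.
Proof.
move=> e; have -> : m%:R = n%:R - N%:R :> R by rewrite -e natrD addrK.
move=> h; have {}h : 2 * N%:R <= n%:R `^ (2 / 3) :> R by lra.
rewrite -(ler_nat R) natrM !natrX.
have -> : n%:R ^+ 2 = (n%:R `^ (2 / 3)) ^+ 3 :> R.
  rewrite -!powR_mulrn ?powR_ge0 ?ler0n // -powRrM.
  by congr powR; field.
have -> : 8 * N%:R ^+ 3 = (2 * N%:R) ^+ 3 :> R by ring.
by rewrite ler_pXn2r ?nnegrE ?powR_ge0 ?mulr_ge0.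
Qed.

(* The reason is y^3 - (9 y / 2 - 27 / 2)^2 = (y - 9)^2 (y - 9 / 4) at y = 2 N. *)
Lemma linear_of_cube_le_sqr (N n : nat) : (8 * N ^ 3 <= n ^ 2)%N -> (9 * N <= n + 13)%N.
Proof.
move=> h; rewrite leqNgt; apply/negP => h'.
have : (8 * N ^ 3 <= (9 * N - 14) ^ 2)%N by apply: leq_trans h _; rewrite leq_sqr; lia.
(* The inequality is tightest around the tangency point [N = 9/2]; from [N = 5] on, the truncated
   subtraction becomes the polynomial [9 * i + 31]. *)
case: (leqP N 4) => [hN | /subnKC <-].
  by move: h'; case: N hN {h} => [|[|[|[|[]]]]] //; lia.
have -> i : (9 * (5 + i) - 14 = 9 * i + 31)%N by lia.
move: (N - 5)%N => i; rewrite !expnS !expn0; nia.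
Qed.

Lemma expR3_bin_le (R : realType) (N n : nat) : (8 * N ^ 3 <= n ^ 2)%N ->
  expR (3 * N%:R) <= 8 * expR 3 * 'C(n.-1, N)%:R :> R.
Proof.
move=> h.
have le_n := linear_of_cube_le_sqr _ _ h; have le_b := expR3_le R.
have q0 : 0 <= 41 / 2 :> R by lra.
have b1 : 1 <= expR 3 :> R by rewrite -[leLHS]expR0 ler_expR.
rewrite mulrC expRM_natl.
have bin_le p : (p <= n.-1)%N -> 'C(p, N)%:R <= 'C(n.-1, N)%:R :> R.
  by move=> hp; rewrite ler_nat leq_bin2l.
(* [bin_slope9_ge] starts at [N = 4], where [N = M + 4] gives [n - 1 >= 9 * M + 22]; smaller [N] use
   explicit lower bounds for [n - 1]. *)
case: N h le_n bin_le => [|[|[|[|M]]]] h le_n bin_le.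
- by rewrite bin0 expr0; lra.
- by have := bin_le 1%N ltac:(nia); rewrite binn expr1; nra.
- by have := bin_le 7%N ltac:(nia); rewrite (_ : 'C(7, 2) = 21)%N // expr2; nra.
- have := bin_le 13%N ltac:(nia); rewrite (_ : 'C(13, 3) = 286)%N // !exprS expr0; nra.
have := bin_le (9 * M + 22)%N ltac:(lia).
have := bin_slope9_ge R M; rewrite !addnS !addn0.
(* One factor [expR 3] is set against the one on the right, so only the power [M + 3] remains to be
   bounded. *)
rewrite (exprS (expR 3)).
have : expR 3 ^+ M.+3 <= (41 / 2) ^+ M.+3 :> R by rewrite lerXn2r ?nnegrE ?expR_ge0.
have : 0 <= (41 / 2) ^+ M.+3 :> R by rewrite exprn_ge0.
have : 0 <= M%:R :> R by [].
move: ((41 / 2) ^+ M.+3) (expR 3 ^+ M.+3) (M%:R) => {h le_n bin_le} y z x.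
move: 'C(_, _)%:R 'C(_, _)%:R => C' C x0 y0 zy hC CC'.
have hy : y <= 8 * C'.
  have x1 : 0 < x + 1 by lra.
  by rewrite -(ler_pM2r x1); have := ler_wpM2r (ltW x1) CC'; nra.
have b0 : 0 <= expR 3 :> R by lra.
by have := ler_wpM2l b0 (le_trans zy hy); lra.
Qed.

Theorem theorem6 (R : realType) (c m n : nat)
    (c_gt0 : (0 < c)%N) (m_gt0 : (0 < m)%N) (n_gt0 : (0 < n)%N)
    (m_ge : n%:R - 2^-1 * n%:R `^ (2 / 3) <= m%:R :> R)
    (m_le : (m <= n)%N) :
  lambda2 R c * n%:R * expR (3 * (n%:R - m%:R)) <= (lcm_quad c m n)%:R.
Proof.
have := bin_le_lcm_quad _ _ _ c_gt0 m_gt0 m_le; rewrite -(ler_nat R) natrM.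
apply: le_trans.
have := expR3_bin_le R _ _ (cube_le_sqr_of_range _ _ _ _ (subnKC m_le) m_ge); rewrite natrB //.
have := lambda2_le R _ c_gt0; have := expR_gt0 (3 : R).
rewrite expRN => e0 h_lambda h_bin.
rewrite (mulrC (lambda2 R c)) -mulrA ler_wpM2l //.
have he : 8 * lambda2 R c * expR 3 <= 1 by rewrite -ler_pdivlMr // mul1r.
have e8 : 0 < 8 * expR 3 :> R by rewrite mulr_gt0.
rewrite -(ler_pM2l e8); apply: le_trans h_bin.
by have := ler_wpM2r (expR_ge0 (3 * (n%:R - m%:R))) he; lra.
Qed.
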